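(* Let $n\ge3$, let $\mathcal{K}\subseteq\mathbb{R}^n$ be a proper subdual cone, and let $A=A^\top\in\mathbb{R}^{n\times n}$. Suppose that $A$ has only two distinct eigenvalues, and the smaller one has multiplicity one. If there exists an eigenvector of $A$ corresponding to the smaller eigenvalue belonging to $\mathcal{K}^*$, then $q_A:\mathbb{S}^{n-1}\cap\operatorname{int}(\mathcal{K})\to\mathbb{R}$, $q_A(x)=\langle Ax,x\rangle$, is spherically quasi-convex.
   Context: $\mathbb{S}^{n-1}=\{x\in\mathbb{R}^n:\|x\|=1\}$. A proper cone is a pointed closed convex cone with nonempty interior; $\mathcal{K}^*=\{y:\langle x,y\rangle\ge0\ \forall x\in\mathcal{K}\}$; $\mathcal{K}$ is subdual if $\mathcal{K}\subseteq\mathcal{K}^*$. For $x,y\in\mathbb{S}^{n-1}$ with $y\ne\pm x$ the minimal geodesic from $x$ to $y$ is the constant-speed parametrization $[0,1]\to\mathbb{S}^{n-1}$ of the shorter great-circle arc from $x$ to $y$. A function $f:\mathcal{S}\to\mathbb{R}$ on $\mathcal{S}=\mathbb{S}^{n-1}\cap\operatorname{int}(\mathcal{K})$ is spherically quasi-convex if for every minimal geodesic segment $\gamma:[0,1]\to\mathcal{S}$ the composition $f\circ\gamma$ is quasi-convex in the usual sense. *)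

(* Defs.v *)
(* Points of R^n are column vectors. *)
From mathcomp Require Import all_boot all_order all_algebra.
From mathcomp Require Import all_classical all_reals all_analysis.
Set Implicit Arguments.
Unset Strict Implicit.
Unset Printing Implicit Defensive.
Import Order.TTheory GRing.Theory Num.Theory.
Import numFieldNormedType.Exports.
Local Open Scope classical_set_scope.
Local Open Scope ring_scope.

Definition dotv (R : realType) (n : nat) (x y : 'cV[R]_n) : R :=
  \sum_(i < n) x i 0 * y i 0.

(* The norm `|x| on matrices is the sup norm, hence a separate Euclidean one. *)
Definition enorm (R : realType) (n : nat) (x : 'cV[R]_n) : R :=
  Num.sqrt (dotv x x).

Definition unit_sphere (R : realType) (n : nat) : set 'cV[R]_n :=
  [set x | enorm x = 1].

Definition cone (R : realType) (n : nat) (K : set 'cV[R]_n) : Prop :=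
  forall (a : R) (x : 'cV[R]_n), 0 < a -> K x -> K (a *: x).

Definition pointed (R : realType) (n : nat) (K : set 'cV[R]_n) : Prop :=
  forall x : 'cV[R]_n, K x -> K (- x) -> x = 0.

(* The topology of 'cV[R]_n is the product topology, i.e. the Euclidean one. *)
Definition proper_cone (R : realType) (n : nat) (K : set 'cV[R]_n) : Prop :=
  [/\ cone K, convex_set K, closed K, pointed K & K° !=set0].

Definition dual_cone (R : realType) (n : nat) (K : set 'cV[R]_n) :
    set 'cV[R]_n :=
  [set y | forall x : 'cV[R]_n, K x -> 0 <= dotv x y].

Definition subdual (R : realType) (n : nat) (K : set 'cV[R]_n) : Prop :=
  K `<=` dual_cone K.

(* For unit vectors x, y with y <> x and y <> - x: the great circle through x
   with unit initial velocity along the component of y orthogonal to x, run at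
   constant speed d(x, y) = acos <x, y> in ]0, pi[, so that it reaches y at
   time t = 1. *)
Definition min_geodesic (R : realType) (n : nat) (x y : 'cV[R]_n) (t : R) :
    'cV[R]_n :=
  let d := acos (dotv x y) in
  let w := y - dotv x y *: x in
  cos (t * d) *: x + sin (t * d) *: ((enorm w)^-1 *: w).

Definition quasiconvex_on (R : realType) (I : set R) (g : R -> R) : Prop :=
  forall s t l : R, I s -> I t -> 0 <= l <= 1 ->
    g ((1 - l) * s + l * t) <= Num.max (g s) (g t).

(* Only the values of f on S matter. *)
Definition spherically_quasiconvex (R : realType) (n : nat)
    (S : set 'cV[R]_n) (f : 'cV[R]_n -> R) : Prop :=
  forall x y : 'cV[R]_n, unit_sphere x -> unit_sphere y -> y <> x -> y <> - x ->
    (forall t : R, 0 <= t <= 1 -> S (min_geodesic x y t)) ->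
    quasiconvex_on `[0, 1]%classic (f \o min_geodesic x y).

Definition quad_form (R : realType) (n : nat) (A : 'M[R]_n) (x : 'cV[R]_n) : R :=
  dotv (A *m x) x.

(* Main.v *)
Require Import Defs.
From mathcomp Require Import all_boot all_order all_algebra.
From mathcomp Require Import all_classical all_reals all_analysis.
From mathcomp Require Import spectral complex ring lra.
Set Implicit Arguments.
Unset Strict Implicit.
Unset Printing Implicit Defensive.
Import Order.TTheory GRing.Theory Num.Theory.
Import numFieldNormedType.Exports.
Local Open Scope classical_set_scope.
Local Open Scope ring_scope.

(** A symmetric matrix [A] with the eigenvalues [lam < mu], the first one simple
and with eigenvector [v], acts as [mu] on the hyperplane orthogonal to [v].
Hence on the unit sphere
[[
  <A x, x> = mu - c <x, v>^2,   c = (mu - lam) / <v, v> >= 0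
]]
(lemma [symmetric_two_eigenvalues]). As [v] lies in the dual cone, [<x, v>] is
nonnegative on the domain of the form, so quasi-convexity of the form along a
geodesic is the same thing as quasi-concavity of [<x, v>]. Along a great circle
[<x, v>] is a sinusoid [p cos + q sin] of the angle, and a sinusoid that is
nonnegative at both ends of an interval shorter than [pi] is nowhere inside
that interval below its smaller end value ([sinusoid_quasiconcave]). Minimal
geodesics cover an angle less than [pi] because their ends are not antipodal
([unit_dotv_bounds]).

The formula for [A] comes from diagonalizing over the reals,
[A = P^-1 diag(d) P]: the algebraic multiplicity of [lam] counts its occurrences
in [d], so [A - mu] has rank one; its range is a line that contains [v], and
symmetry of [A] gives the coefficient. *)

(** * Diagonalization *)

(** The spectral theorem holds over the algebraically closed field [R[i]]. A
symmetric real matrix is Hermitian there, so its diagonal form is real, and two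
real matrices that are similar over [R[i]] are similar by a matrix with real
entries; taking real parts brings everything back to [R]. *)
Lemma symmetric_diagonalizable (R : rcfType) (n : nat) (A : 'M[R]_n) :
  A = A^T ->
  exists2 P : 'M[R]_n, P \in unitmx &
    exists d : 'rV[R]_n, A = invmx P *m diag_mx d *m P.
Proof.
move=> symA.
pose toC := real_complex R.
pose B := map_mx toC A.
have realC m p (M : 'M[R]_(m, p)) : map_mx toC M \is a realmx.
  by apply/mxOverP => i j; rewrite mxE complex_real.
have hermB : B \is hermsymmx.
  apply: realsym_hermsym (realC _ _ A).
  by apply/is_hermitianmxP; rewrite expr0 scale1r map_mx_id// /B map_trmx -symA.
have := hermitian_spectral_diag_real hermB.
have /hermitian_normalmx /orthomx_spectralP := hermB.
set Q := spectralmx B; set e := spectral_diag B => eqB reale.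
have Qu : Q \in unitmx by exact: spectral_unit.
pose d := map_mx (@complex.Re R) e.
have ed : e = map_mx toC d.
  apply/matrixP => i j; rewrite !mxE; apply/esym/RRe_real.
  by have /mxOverP := reale; apply.
have simB : similar_in unitmx B (diag_mx e).
  exists Q => //; apply/similarP => //.
  by rewrite eqB !mulmxA mulmxV// mul1mx.
have [|S /= /andP[/= realS unitS] /(similarP unitS) eqS] :=
  real_similar simB (realC _ _ A).
  by rewrite ed -map_diag_mx; exact: realC.
pose P := map_mx (@complex.Re R) S.
have SP : S = map_mx toC P.
  apply/matrixP => i j; rewrite !mxE; apply/esym/RRe_real.
  by have /mxOverP := realS; apply.
have Pu : P \in unitmx by rewrite -(map_unitmx toC) -SP.
exists P => //; exists d.
have /map_mx_inj eqP : map_mx toC (P *m A) = map_mx toC (diag_mx d *m P).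
  by rewrite !map_mxM/= -SP map_diag_mx -ed.
by rewrite -mulmxA -eqP mulmxA mulVmx// mul1mx.
Qed.

Lemma char_poly_similar (F : fieldType) (n : nat) (P D : 'M[F]_n) :
  P \in unitmx -> char_poly (invmx P *m D *m P) = char_poly D.
Proof.
move=> Pu; pose toP := @polyC F.
have eqX : char_poly_mx (invmx P *m D *m P) =
    map_mx toP (invmx P) *m char_poly_mx D *m map_mx toP P.
  rewrite /char_poly_mx mulmxBr mulmxBl !map_mxM/= scalar_mxC.
  by rewrite -(mulmxA 'X%:M) -(map_mxM _ (invmx P) P) mulVmx// map_mx1 mulmx1.
rewrite /char_poly eqX !det_mulmx mulrAC -det_mulmx.
by rewrite -(map_mxM _ (invmx P) P) mulVmx// map_mx1 det1 mul1r.
Qed.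

(** The characteristic polynomial is the product of the [X - d_i], so every entry
of [d] is an eigenvalue, and the multiplicity of [lam] is the number of its
occurrences in [d]. *)
Lemma diagonalized_simple_eigenvalue (F : fieldType) (n : nat)
    (P : 'M[F]_n) (d : 'rV[F]_n) (lam mu : F) :
  P \in unitmx ->
  (forall a, eigenvalue (invmx P *m diag_mx d *m P) a -> a = lam \/ a = mu) ->
  mup lam (char_poly (invmx P *m diag_mx d *m P)) = 1%N ->
  exists i0, d = \row_i (if i == i0 then lam else mu).
Proof.
move=> Pu spec.
have charE : char_poly (invmx P *m diag_mx d *m P) =
    \prod_(a <- [seq d 0 i | i <- enum 'I_n]) ('X - a%:P).
  rewrite char_poly_similar// char_poly_trig ?diag_mx_is_trig// big_map big_enum.
  by apply: eq_bigr => i _; rewrite mxE eqxx mulr1n.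
have dE i : d 0 i = lam \/ d 0 i = mu.
  apply: spec; rewrite eigenvalue_root_char charE root_prod_XsubC.
  by apply: map_f; rewrite mem_enum.
have cardE_lam : count_mem lam [seq d 0 i | i <- enum 'I_n] =
    #|[pred i | d 0 i == lam]|.
  by rewrite count_map enumT cardE size_filter.
rewrite charE mu_prod_XsubC cardE_lam => /mem_card1[i0 i0P]; exists i0.
apply/rowP => i; rewrite mxE.
have := i0P i; rewrite !inE.
case: eqVneq => [-> <-//| ne <-].
by case: (dE i) => // /eqP; rewrite (negPf ne).
Qed.

(** * The Euclidean inner product *)

Lemma dotvC (R : realType) (n : nat) (x y : 'cV[R]_n) : dotv x y = dotv y x.
Proof. by apply: eq_bigr => i _; rewrite mulrC. Qed.

Lemma dotv_mulmx (R : realType) (n : nat) (x y : 'cV[R]_n) :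
  dotv x y = (x^T *m y) 0 0.
Proof. by rewrite mxE; apply: eq_bigr => i _; rewrite mxE. Qed.

Lemma dotvDl (R : realType) (n : nat) (x y z : 'cV[R]_n) :
  dotv (x + y) z = dotv x z + dotv y z.
Proof. by rewrite !dotv_mulmx linearD mulmxDl mxE. Qed.

Lemma dotvZl (R : realType) (n : nat) (a : R) (x y : 'cV[R]_n) :
  dotv (a *: x) y = a * dotv x y.
Proof. by rewrite !dotv_mulmx linearZ -scalemxAl mxE. Qed.

Lemma dotv_symmetric (R : realType) (n : nat) (A : 'M[R]_n) (x y : 'cV[R]_n) :
  A = A^T -> dotv (A *m x) y = dotv x (A *m y).
Proof. by move=> symA; rewrite !dotv_mulmx trmx_mul -symA mulmxA. Qed.

Lemma dotv_ge0 (R : realType) (n : nat) (x : 'cV[R]_n) : 0 <= dotv x x.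
Proof. by apply: sumr_ge0 => i _; rewrite -expr2 sqr_ge0. Qed.

Lemma dotv_gt0 (R : realType) (n : nat) (x : 'cV[R]_n) :
  x <> 0 -> 0 < dotv x x.
Proof.
move=> x0; rewrite lt0r dotv_ge0 andbT; apply/eqP => xx0; apply: x0.
apply/colP => i; rewrite mxE; apply/eqP; rewrite -sqrf_eq0 expr2.
by apply/eqP; apply: (psumr_eq0P _ xx0) => // j _; rewrite -expr2 sqr_ge0.
Qed.

Lemma unit_sphere_dotv (R : realType) (n : nat) (x : 'cV[R]_n) :
  unit_sphere x -> dotv x x = 1.
Proof.
by move=> x1; rewrite -(sqr_sqrtr (dotv_ge0 x)) -/(enorm x) x1 expr1n.
Qed.

(** The bounds are Cauchy-Schwarz for unit vectors, read off from
[<x + y, x + y> > 0] and [<y - x, y - x> >= 0]. *)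
Lemma unit_dotv_bounds (R : realType) (n : nat) (x y : 'cV[R]_n) :
  unit_sphere x -> unit_sphere y -> y <> - x -> -1 < dotv x y <= 1.
Proof.
move=> /unit_sphere_dotv xx /unit_sphere_dotv yy yNx.
have sum_gt0 : 0 < dotv (y + x) (y + x).
  by apply: dotv_gt0 => /eqP; rewrite addr_eq0 => /eqP.
have diff_ge0 := dotv_ge0 (y + (-1) *: x).
apply/andP; split.
  move: sum_gt0; rewrite dotvDl !(dotvC _ (y + x)) !dotvDl xx yy (dotvC y x).
  lra.
move: diff_ge0; rewrite dotvDl dotvZl !(dotvC _ (y + (-1) *: x)) !dotvDl !dotvZl.
rewrite xx yy (dotvC y x); lra.
Qed.

(** * Symmetric matrices with two eigenvalues, one of them simple *)

(** In a diagonalizing basis [A - mu] has a single nonzero entry, so its range is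
a line; that line contains [(A - mu) v = (lam - mu) v], hence is spanned by
[v]. The coefficient of [A x - mu x] along [v] follows by pairing with [v] and
moving [A] to the other side. *)
Lemma symmetric_two_eigenvalues (R : realType) (n : nat) (A : 'M[R]_n)
    (lam mu : R) (v x : 'cV[R]_n) :
  A = A^T -> lam != mu ->
  (forall a, eigenvalue A a -> a = lam \/ a = mu) ->
  mup lam (char_poly A) = 1%N ->
  v <> 0 -> A *m v = lam *: v ->
  A *m x = mu *: x - ((mu - lam) * (dotv x v / dotv v v)) *: v.
Proof.
move=> symA ne_lam_mu spec simple v0 Av.
have [P Pu [d dA]] := symmetric_diagonalizable symA.
have [i0 dE] : exists i0, d = \row_i (if i == i0 then lam else mu).
  by apply: (diagonalized_simple_eigenvalue Pu); rewrite -dA.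
pose u := invmx P *m delta_mx i0 0 : 'cV[R]_n.
have Ax y : A *m y = mu *: y + ((lam - mu) * (P *m y) i0 0) *: u.
  rewrite /u scalemxAr -[in mu *: y](mulKmx Pu y) scalemxAr -mulmxDr.
  rewrite dA -!mulmxA; congr (_ *m _).
  apply/colP => i; rewrite dE mul_diag_mx !mxE.
  by case: eqVneq => [->|_] /=; ring.
have vu : v = (P *m v) i0 0 *: u.
  have := Ax v; rewrite Av => eqv.
  apply: (@scalerI _ _ (lam - mu)); first by rewrite subr_eq0.
  by rewrite scalerA scalerBl eqv addrAC subrr add0r.
have b0 : (P *m v) i0 0 != 0.
  by apply/eqP => b0; apply: v0; rewrite vu b0 scale0r.
(* [u] is a multiple of [v], so the range of [A - mu] is spanned by [v]. *)
have [k Ak] : exists k, A *m x = mu *: x + k *: v.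
  exists ((lam - mu) * (P *m x) i0 0 / (P *m v) i0 0).
  by rewrite Ax [X in _ = _ + _ *: X]vu scalerA divfK.
have vv := dotv_gt0 v0.
have : dotv (A *m x) v = lam * dotv x v.
  by rewrite dotv_symmetric// Av dotvC dotvZl dotvC.
rewrite Ak dotvDl !dotvZl => eqk; congr (_ + _); rewrite -scaleNr.
congr (_ *: _); apply: (mulIf (lt0r_neq0 vv)).
have -> : - ((mu - lam) * (dotv x v / dotv v v)) * dotv v v =
  (lam - mu) * dotv x v by field; exact: lt0r_neq0.
by rewrite mulrBl -eqk; ring.
Qed.

(** * Sinusoids *)

(** With [phi] and [psi] the distances from the intermediate point [m] to the two
ends, [sin (phi + psi) f(m) = sin psi f(a) + sin phi f(b)]. All the sines are
nonnegative, and [sin (phi + psi) <= sin phi + sin psi], so the right-hand side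
is at least [sin (phi + psi)] times the smaller of the two end values, which
is nonnegative. Dividing by [sin (phi + psi) > 0] uses that the interval is
shorter than [pi]. *)
Lemma sinusoid_quasiconcave (R : realType) (p q a b l : R) :
  `|b - a| < pi -> 0 <= l <= 1 ->
  let f x := cos x * p + sin x * q in
  0 <= f a -> 0 <= f b -> Num.min (f a) (f b) <= f ((1 - l) * a + l * b).
Proof.
move=> + + f; wlog le_ab : a b l / a <= b => [hw|].
  have [le_ab|/ltW le_ba] := leP a b; first exact: hw.
  move=> ba l01 fa fb; rewrite minC.
  rewrite (_ : (1 - l) * a + l * b = (1 - (1 - l)) * b + (1 - l) * a); last ring.
  by apply: hw => //; [rewrite distrC|lra].
rewrite ger0_norm ?subr_ge0// => ltpi /andP[l0 l1] fa fb.
have [eq_ab|ne_ab] := eqVneq a b.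
  by rewrite -eq_ab minxx -mulrDl subrK mul1r.
have lt_ab : 0 < b - a by rewrite subr_gt0 lt_neqAle ne_ab.
set m := (1 - l) * a + l * b.
pose phi := m - a; pose psi := b - m.
have phiE : phi = l * (b - a) by rewrite /phi /m; ring.
have psiE : psi = (1 - l) * (b - a) by rewrite /psi /m; ring.
have phi0 : 0 <= phi <= pi by rewrite phiE; nra.
have psi0 : 0 <= psi <= pi by rewrite psiE; nra.
have sumE : b - a = phi + psi by rewrite /phi /psi; ring.
have interp : sin (phi + psi) * f m = sin psi * f a + sin phi * f b.
  have -> : a = m - phi by rewrite /phi; ring.
  have -> : b = m + psi by rewrite /psi; ring.
  by rewrite /f !(cosD, sinD, cosN, sinN); ring.
have s0 : 0 < sin (phi + psi) by apply: sin_gt0_pi; rewrite -sumE lt_ab.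
have sphi := sin_ge0_pi phi0; have spsi := sin_ge0_pi psi0.
have ssum : sin (phi + psi) <= sin phi + sin psi.
  rewrite sinD; have := cos_le1 phi; have := cos_le1 psi; nra.
rewrite -(ler_pM2l s0) interp.
have [ma mb] : Num.min (f a) (f b) <= f a /\ Num.min (f a) (f b) <= f b.
  by rewrite !ge_min !lexx orbT.
have mn0 : 0 <= Num.min (f a) (f b) by rewrite le_min fa.
nra.
Qed.

(** * Quasi-convexity of the quadratic form *)

Theorem theorem5p4p4 (R : realType) (n : nat) (hn : (3 <= n)%N)
    (K : set 'cV[R]_n) (hK : proper_cone K) (hsub : subdual K)
    (A : 'M[R]_n) (hA : A = A^T)
    (lam mu : R) (hlt : lam < mu)
    (hspec : forall a : R, eigenvalue A a <-> a = lam \/ a = mu)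
    (hmult : mup lam (char_poly A) = 1%N)
    (hv : exists v : 'cV[R]_n,
        [/\ v <> 0, A *m v = lam *: v & dual_cone K v]) :
  spherically_quasiconvex (@unit_sphere R n `&` K°) (quad_form A).
Proof.
have [v [v0 Av Kv]] := hv.
have vv := dotv_gt0 v0.
pose c := (mu - lam) / dotv v v.
have ne_lm : lam != mu by rewrite lt_eqF.
have c0 : 0 <= c by rewrite divr_ge0 ?subr_ge0 ?ltW.
have qE x : unit_sphere x -> quad_form A x = mu - c * dotv x v ^+ 2.
  move=> /unit_sphere_dotv xx; rewrite /quad_form.
  rewrite (symmetric_two_eigenvalues x hA ne_lm (fun a => (hspec a).1) hmult v0 Av).
  rewrite -scaleNr dotvDl !dotvZl xx (dotvC v x) /c.
  ring.
move=> x y x1 y1 _ yNx Sg s t l s01 t01 l01.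
set g := min_geodesic x y.
pose d := acos (dotv x y).
have /andP[xy_gtN1 xy_le1] := unit_dotv_bounds x1 y1 yNx.
have d0 : 0 <= d by apply: acos_ge0; rewrite ltW.
have dpi : d < pi by apply: acos_ltpi; rewrite xy_gtN1.
have I01 r : `[0, 1]%classic r -> 0 <= r <= 1 by rewrite /= in_itv.
have g1 r : 0 <= r <= 1 -> unit_sphere (g r) by move=> /Sg[].
have gv r : 0 <= r <= 1 -> 0 <= dotv (g r) v.
  by move=> /Sg[_ /interior_subset]; exact: Kv.
move/I01 : s01 => s01; move/I01 : t01 => t01.
have m01 : 0 <= (1 - l) * s + l * t <= 1 by nra.
pose q := dotv ((enorm (y - dotv x y *: x))^-1 *: (y - dotv x y *: x)) v.
have gE r : dotv (g r) v = cos (r * d) * dotv x v + sin (r * d) * q.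
  by rewrite /q dotvDl !dotvZl.
have st : `|t * d - s * d| < pi by rewrite ltr_norml; apply/andP; split; nra.
have := @sinusoid_quasiconcave R (dotv x v) q _ _ l st l01.
rewrite /= -!gE.
have -> : (1 - l) * (s * d) + l * (t * d) = ((1 - l) * s + l * t) * d by ring.
rewrite -gE => /(_ (gv _ s01) (gv _ t01)).
rewrite /= !qE; [|exact: g1..].
have gs := gv _ s01; have gt := gv _ t01.
(* Squaring preserves the order between these nonnegative inner products, and
   the factor [- c] reverses it. *)
rewrite ge_min le_max => /orP[le|le]; apply/orP; [left|right].
  by rewrite lerD2l lerN2 ler_wpM2l// ler_sqr// nnegrE ?(le_trans _ le).
by rewrite lerD2l lerN2 ler_wpM2l// ler_sqr// nnegrE ?(le_trans _ le).
Qed.
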